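(* Let $\alpha\in\{132,321,213\}$. For $n\ge1$ and $0\le k\le n$, $$s_n^k(\alpha)=\sum_{j=0}^{n-k}(-1)^j\binom{j+k}{k}C_n^{(k+j)}=\sum_{j=0}^{n-k}(-1)^j\,\frac{j+k+1}{n+1}\binom{2n-k-j}{n}\binom{j+k}{k}.$$
   Context: $s_n^k(\alpha)$ is the number of permutations $\pi=\pi_1\cdots\pi_n$ of $\{1,\dots,n\}$ avoiding $\alpha$ (no indices $i<j<l$ with $\pi_i\pi_j\pi_l$ order-isomorphic to $\alpha$) with exactly $k$ fixed points (indices $i$ with $\pi_i=i$). For $0\le k\le n$, $C_n^{(k)}=\frac{k+1}{n+1}\binom{2n-k}{n}$. *)

(* Defs.v *)
From mathcomp Require Import all_boot all_order all_algebra all_fingroup.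

Set Implicit Arguments.
Unset Strict Implicit.
Unset Printing Implicit Defensive.

Import GRing.Theory Num.Theory.

Definition order_iso (s t : seq nat) : bool :=
  (size s == size t) &&
  [forall a : 'I_(size s), forall b : 'I_(size s),
     (nth 0 s a < nth 0 s b) == (nth 0 t a < nth 0 t b)].

(* Patterns are words in one-line notation, e.g. [:: 1; 3; 2] for 132.
   Permutations of {1, .., n} are represented by 'S_n, i.e. shifted to
   {0, .., n-1}; this affects neither order isomorphism nor fixed points. *)
Definition avoids (alpha : seq nat) (n : nat) (pi : 'S_n) : bool :=
  [forall i : 'I_n, forall j : 'I_n, forall l : 'I_n,
     (i < j < l) ==>
       ~~ order_iso [:: val (pi i); val (pi j); val (pi l)] alpha].

Definition fixed_points (n : nat) (pi : 'S_n) : {set 'I_n} :=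
  [set i : 'I_n | pi i == i].

Definition s_count (alpha : seq nat) (n k : nat) : nat :=
  #|[set pi : 'S_n | avoids alpha pi & #|fixed_points pi| == k]|.

Definition Cnk (n k : nat) : rat :=
  (k.+1%:R / n.+1%:R * 'C(2 * n - k, n)%:R)%R.

(* Main.v *)
(** Let [c] be the Catalan series.  Write [M n k] for the number of pairs of an
    [alpha]-avoiding permutation of size [n] and a set of [k] of its fixed
    points, so that [s_n^k] is obtained from [M n (k + j)] by binomial inversion;
    it must be shown that [M n k = C_n^(k)], the coefficient of [x^n] in
    [x^k c^(k+1)].

    Removing one marked fixed point [i] splits an avoider of size [n + 1] into
    two avoiders [sigma], [tau] of total size [n], and the other fixed points are
    those of [sigma] together with those of [tau].  For 321, [sigma] and [tau]
    are what lies before and after [i].  For 132, the entries to the left of and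
    below [i] form together with [i] a block on the diagonal, whose position is
    determined by the remaining permutation [tau] (see [cut132]).  Hence the
    generating function [F(q)] by fixed points satisfies [dF/dq = x F^2], which
    together with [F(1) = c] determines [M].

    Both classes are counted by [c] because the avoiders of size [n + 1] arise
    from those of size [n] by inserting the maximum (for 321) or the minimum
    (for 132) in front of an increasing final segment.  Reverse-complement
    exchanges 132 and 213 and preserves the number of fixed points. *)
Require Import Defs.
From mathcomp Require Import all_boot all_order all_algebra all_fingroup.
From mathcomp Require Import zify ring.

Set Implicit Arguments.
Unset Strict Implicit.
Unset Printing Implicit Defensive.

Import GRing.Theory Num.Theory.

(** * Ballot numbers *)

(* The coefficient of [x^m] in [c(x)^j], for the Catalan series [c]. *)
Fixpoint catalan_conv (m j : nat) : nat :=
  if m is m'.+1 then \sum_(i < j) catalan_conv m' i.+2 else 1.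

(** Coefficient form of [c^(j+1) = c^j + x c^(j+2)], which is [c = 1 + x c^2] multiplied by
    [c^j]. *)
Lemma catalan_convSS m j :
  catalan_conv m.+1 j.+1 = catalan_conv m.+1 j + catalan_conv m j.+2.
Proof. by rewrite /= big_ord_recr. Qed.

Lemma catalan_conv_S0 m : catalan_conv m.+1 0 = 0.
Proof. by rewrite /= big_ord0. Qed.

(** The ballot formula, with its denominator cleared to stay in [nat]. The recursion above is
    matched with Pascal's rule. *)
Lemma catalan_conv_closed m j :
  catalan_conv m j.+1 * (m + j.+1) = j.+1 * 'C(2 * m + j, m).
Proof.
elim: m j => [|m IHm] j; first by rewrite /= bin0; lia.
elim: j => [|j IHj].
  rewrite catalan_convSS catalan_conv_S0 add0n.
  have H1 := IHm 1.
  have -> : 2 * m.+1 + 0 = (2 * m + 1).+1 by lia.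
  rewrite binS; have H2 : 'C(2 * m + 1, m.+1) = 'C(2 * m + 1, m).
    apply/eqP; rewrite -(eqn_pmul2l (ltn0Sn m)) mul_bin_left; apply/eqP.
    by congr (_ * _); lia.
  by rewrite H2; lia.
rewrite catalan_convSS.
have -> : 2 * m.+1 + j.+1 = (2 * m + j.+2).+1 by lia.
have H2 := mul_bin_left (2 * m + j.+2) m.
have H1 := IHm j.+2.
move: IHj; have -> : 2 * m.+1 + j = 2 * m + j.+2 by lia.
rewrite binS; move: H1 H2.
set X := 'C(_, m); set Y := 'C(_, m.+1).
move: (catalan_conv m j.+3) (catalan_conv m.+1 j.+1) => a b H1 H2 H3.
have Hb : b * (m + j.+2) = j.+1 * Y by rewrite -H3; congr (_ * _); lia.
have Ha : a * (m + j.+3) = j.+3 * X by rewrite -H1.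
have HXY : m.+1 * Y = (m + j.+2) * X by rewrite H2; congr (_ * _); lia.
(* The positive factors [m.+1] and [m + j.+2] are added so that [Hb], [Ha] and [HXY] apply without
   division; they are cancelled at the end. *)
have : (m.+1 * ((b + a) * (m + j.+3))) * (m+j.+2) = (m.+1 * (j.+2 * (Y + X))) * (m+j.+2).
  transitivity (m.+1 * (m + j.+3) * (b * (m + j.+2))
    + m.+1 * (m + j.+2) * (a * (m + j.+3))); first by ring.
  rewrite Hb Ha.
  transitivity ((m.+1 * Y) * j.+1 * (m + j.+3) + m.+1 * (m + j.+2) * j.+3 * X); first by ring.
  transitivity ((m.+1 * Y) * j.+2 * (m + j.+2) + m.+1 * (m + j.+2) * j.+2 * X); last by ring.
  by rewrite HXY; ring.
move/eqP; rewrite eqn_pmul2r; last by lia.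
rewrite eqn_pmul2l // => /eqP; lia.
Qed.

(** This is [c^i c^j = c^(i+j)]: as functions of [i], both sides obey the recursion
    [catalan_convSS]. *)
Lemma catalan_conv_conv m i j :
  \sum_(a < m.+1) catalan_conv a i * catalan_conv (m - a) j
    = catalan_conv m (i + j).
Proof.
elim: m i j => [|m IHm] i j; first by rewrite big_ord1.
elim: i => [|i IHi].
  rewrite big_ord_recl big1 => [|a _]; last by rewrite lift0 catalan_conv_S0.
  by rewrite subn0 addn0 mul1n.
rewrite addSn catalan_convSS -IHi -(IHm i.+2 j).
rewrite big_ord_recl [in RHS]big_ord_recl -addnA; congr (_ + _).
rewrite -big_split; apply: eq_bigr => a _.
by rewrite lift0 catalan_convSS mulnDl.
Qed.

Lemma Cnk_catalan_conv n k : k <= n ->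
  Cnk n k = ((catalan_conv (n - k) k.+1)%:R)%R.
Proof.
move=> hk; rewrite /Cnk.
have H := catalan_conv_closed (n - k) k.
have -> : 'C(2 * n - k, n) = 'C(2 * (n - k) + k, n - k).
  rewrite -bin_sub; [|lia]; congr ('C(_, _)); lia.
have H' : catalan_conv (n - k) k.+1 * n.+1 = k.+1 * 'C(2 * (n - k) + k, n - k).
  by rewrite -H; congr (_ * _); lia.
have n0 : (n.+1%:R != 0 :> rat)%R by rewrite pnatr_eq0.
by rewrite mulrAC -natrM -H' natrM mulfK.
Qed.

(* The integer [C_n^(k)], extended by zero; [Cnk] itself does not vanish for
   [k > n = 0] because of truncated subtraction. *)
Definition ballot n k := if k <= n then catalan_conv (n - k) k.+1 else 0.

(** The product of [x^i c^(i+1)] and [x^(k-i) c^(k-i+1)] is [x^k c^(k+2)], whose coefficients do not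
    depend on [i]. *)
Lemma ballot_conv m k i : i <= k ->
  \sum_(s < m.+1) ballot s i * ballot (m - s) (k - i) = ballot m.+1 k.+1.
Proof.
move=> hik; rewrite /ballot ltnS.
case: (leqP k m) => hkm; last first.
  apply: big1 => s _; case: ifP => // h1; case: ifP => //; have := ltn_ord s; lia.
have -> : k.+2 = i.+1 + (k - i).+1 by lia.
rewrite subSS -catalan_conv_conv.
rewrite -(big_mkord predT (fun s => (if i <= s then catalan_conv (s - i) i.+1 else 0) *
   (if k - i <= m - s then catalan_conv (m - s - (k - i)) (k - i).+1 else 0))).
rewrite -[RHS](big_mkord predT (fun a => catalan_conv a i.+1 * catalan_conv (m - k - a) (k - i).+1)).
(* Only [i <= s <= m - (k - i)] contributes: outside this range one of the two factors vanishes. *)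
rewrite (@big_cat_nat _ _ _ i) //=; last by lia.
rewrite big_nat big1 ?add0n; last by move=> s hs; case: ifP => //; lia.
rewrite (@big_cat_nat _ _ _ (m.+1 - (k - i))) //=; try lia.
rewrite [X in _ + X]big_nat [X in _ + X]big1 ?addn0; last first.
  by move=> s hs; case: ifP => //; case: ifP => //; lia.
rewrite -{1}[i]add0n big_addn.
have -> : m.+1 - (k - i) - i = (m - k).+1 by lia.
rewrite big_nat [RHS]big_nat; apply: eq_bigr => s hs.
rewrite leq_addl addnK ifT; last by lia.
by congr (_ * catalan_conv _ _); lia.
Qed.

Lemma ballotSS n k : ballot n.+1 k.+1 = ballot n k + ballot n.+1 k.+2.
Proof.
rewrite /ballot !ltnS subSS; case: (leqP k n) => hkn; last by rewrite ifF //; lia.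
case: (ltnP k n) => hk.
  by rewrite subSS -(subnSK hk) catalan_convSS.
by rewrite (_ : n - k = 0) ?addn0 //; lia.
Qed.

Lemma ballotS0 n : ballot n.+1 0 = ballot n.+1 1.
Proof. by rewrite /ballot /= subSS subn0 big_ord_recl big_ord0 addn0. Qed.

Lemma ballot_gt n k : n < k -> ballot n k = 0.
Proof. by rewrite /ballot ltnNge => /negbTE ->. Qed.

(** * Permutations as words *)

(** The pigeonhole principle on integer intervals, which links ranges of positions in a word with
    ranges of values. *)
Section IntervalInjections.
Variables (f : nat -> nat) (a b : nat).
Hypothesis f_inj : forall x y, a <= x < b -> a <= y < b -> f x = f y -> x = y.

Let im := [seq f x | x <- iota a (b - a)].

Let im_uniq : uniq im.
Proof.
rewrite map_inj_in_uniq ?iota_uniq // => x y.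
by rewrite !mem_iota => hx hy; apply: f_inj; lia.
Qed.

Lemma interval_inj_leq c d :
  (forall x, a <= x < b -> c <= f x < d) -> b - a <= d - c.
Proof.
move=> fP; rewrite -(size_iota a (b - a)) -(size_map f) -(size_iota c (d - c)).
apply: uniq_leq_size im_uniq _ => _ /mapP[x + ->].
by rewrite !mem_iota => hx; have := fP x; lia.
Qed.

Lemma interval_inj_surj c :
  (forall x, a <= x < b -> c <= f x < c + (b - a)) ->
  forall v, c <= v < c + (b - a) -> exists2 x, a <= x < b & f x = v.
Proof.
move=> fP v hv.
have sub : {subset im <= iota c (b - a)}.
  by move=> _ /mapP[x + ->]; rewrite !mem_iota => hx; have := fP x; lia.
have sz : size (iota c (b - a)) <= size im by rewrite size_map !size_iota.
have [_ eqim] := uniq_min_size im_uniq sub sz.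
have : v \in im by rewrite eqim mem_iota; lia.
by case/mapP=> x; rewrite mem_iota => hx ->; exists x => //; lia.
Qed.

End IntervalInjections.

(** A pattern is a predicate on three values taken in the order of their positions, so that 321 and
    132 can be treated uniformly. *)
Definition pattern_free (P : nat -> nat -> nat -> bool) (w : seq nat) : bool :=
  all (fun l => all (fun j => all (fun i =>
    ~~ P (nth 0 w i) (nth 0 w j) (nth 0 w l)) (iota 0 j)) (iota 0 l))
  (iota 0 (size w)).

Definition fixw (w : seq nat) : nat :=
  count (fun i => nth 0 w i == i) (iota 0 (size w)).

Definition Av P n : seq (seq nat) :=
  [seq w <- permutations (iota 0 n) | pattern_free P w].

Definition perm_word n (w : seq nat) : Prop :=
  [/\ size w = n, forall x, x < n -> nth 0 w x < n
    & forall x y, x < n -> y < n -> nth 0 w x = nth 0 w y -> x = y].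

Lemma pattern_freeP P w :
  reflect (forall i j l, i < j -> j < l -> l < size w ->
             ~~ P (nth 0 w i) (nth 0 w j) (nth 0 w l))
          (pattern_free P w).
Proof.
apply: (iffP allP) => [H i j l hij hjl hl | H l].
  have io x y : x < y -> x \in iota 0 y by rewrite mem_iota.
  by have /allP/(_ _ (io _ _ hjl))/allP/(_ _ (io _ _ hij)) := H l (io _ _ hl).
rewrite mem_iota => hl; apply/allP => j; rewrite mem_iota => hj.
by apply/allP => i; rewrite mem_iota => hi; apply: H.
Qed.

Lemma perm_wordP n w : reflect (perm_word n w) (perm_eq w (iota 0 n)).
Proof.
apply: (iffP idP) => [pw | [sw bw iw]].
  have sw : size w = n by rewrite (perm_size pw) size_iota.
  split=> // [x hx | x y hx hy].
    have : nth 0 w x \in w by rewrite mem_nth ?sw.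
    by rewrite (perm_mem pw) mem_iota.
  have uw : uniq w by rewrite (perm_uniq pw) iota_uniq.
  by move/eqP; rewrite nth_uniq ?sw // => /eqP.
have uw : uniq w by apply/(uniqP 0) => x y; rewrite !inE sw; apply: iw.
apply: uniq_perm => //; first exact: iota_uniq.
suff sub : {subset w <= iota 0 n}.
  by have [|_] := uniq_min_size uw sub; first by rewrite size_iota sw.
move=> _ /(nthP 0)[x hx <-]; by rewrite mem_iota /= add0n bw // -sw.
Qed.

Lemma mem_Av P n (w : seq nat) :
  w \in Av P n <-> perm_word n w /\ pattern_free P w.
Proof.
rewrite mem_filter mem_permutations.
by split=> [/andP[? /perm_wordP] | [/perm_wordP -> ->]].
Qed.

Lemma Av_uniq P n : uniq (Av P n).
Proof. by rewrite filter_uniq ?permutations_uniq. Qed.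

Lemma perm_word_size n w : perm_word n w -> size w = n.
Proof. by case. Qed.

(** The increasing injection whose image omits exactly the [r] numbers from [t] on; it serves for
    positions as well as for values. *)
Definition shift t r v := if v < t then v else v + r.

Lemma shift_mono t r u v : (shift t r u < shift t r v) = (u < v).
Proof. by rewrite /shift; case: ifP; case: ifP; lia. Qed.

Lemma shift_inj t r : injective (shift t r).
Proof. by move=> u v; rewrite /shift; case: ifP; case: ifP; lia. Qed.

(* Inserts [rho] into [tau] as a block occupying the positions from [t] on and
   the values from [u] on. *)
Definition inflate t u (rho tau : seq nat) : seq nat :=
  mkseq (fun x =>
    if x < t then shift u (size rho) (nth 0 tau x)
    else if x < t + size rho then u + nth 0 rho (x - t)
    else shift u (size rho) (nth 0 tau (x - size rho))) (size rho + size tau).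

Lemma size_inflate t u rho tau : size (inflate t u rho tau) = size rho + size tau.
Proof. by rewrite size_mkseq. Qed.

Lemma nth_inflate_in t u rho tau y : t <= size tau -> y < size rho ->
  nth 0 (inflate t u rho tau) (t + y) = u + nth 0 rho y.
Proof.
move=> ht hy; rewrite nth_mkseq; last by lia.
by rewrite ifF ?ifT ?addKn //; lia.
Qed.

Lemma nth_inflate_out t u rho tau y : t <= size tau -> y < size tau ->
  nth 0 (inflate t u rho tau) (shift t (size rho) y)
    = shift u (size rho) (nth 0 tau y).
Proof.
move=> ht hy; rewrite {1}/shift; case: ifP => hyt.
  by rewrite nth_mkseq ?hyt //; lia.
by rewrite nth_mkseq ?ifF ?addnK //; lia.
Qed.

Variant inflate_pos t (rho tau : seq nat) x : Prop :=
| InflateIn y of y < size rho & x = t + y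
| InflateOut y of y < size tau & x = shift t (size rho) y.

Lemma inflateP t rho tau x : t <= size tau -> x < size rho + size tau ->
  inflate_pos t rho tau x.
Proof.
move=> ht hx; case: (ltnP x t) => h1.
  by apply: (@InflateOut _ _ _ _ x); rewrite /shift ?h1 //; lia.
case: (ltnP x (t + size rho)) => h2.
  by apply: (@InflateIn _ _ _ _ (x - t)); lia.
by apply: (@InflateOut _ _ _ _ (x - size rho)); rewrite /shift ?ifF; lia.
Qed.

Lemma perm_word_inflate t u r m rho tau : t <= m -> u <= m ->
  perm_word r rho -> perm_word m tau -> perm_word (r + m) (inflate t u rho tau).
Proof.
move=> htm hum [sr br ir] [st bt it]; have ht : t <= size tau by rewrite st.
split; first by rewrite size_inflate sr st.
  rewrite -sr -st => x hx; case: (inflateP ht hx) => [y hy ->|y hy ->].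
    by rewrite nth_inflate_in //; have := br y; lia.
  by rewrite nth_inflate_out // /shift; have := bt y; case: ifP; lia.
rewrite -sr -st => x y hx hy.
case: (inflateP ht hx) => [x' hx' ->|x' hx' ->].
  case: (inflateP ht hy) => [y' hy' ->|y' hy' ->].
    rewrite !nth_inflate_in // => /addnI h.
    by congr (_ + _); apply: ir => //; lia.
  rewrite nth_inflate_in ?nth_inflate_out // /shift.
  by have := br x'; case: ifP; lia.
case: (inflateP ht hy) => [y' hy' ->|y' hy' ->].
  rewrite nth_inflate_in ?nth_inflate_out // /shift.
  by have := br y'; case: ifP; lia.
rewrite !nth_inflate_out // => /shift_inj h.
by congr shift; apply: it => //; lia.
Qed.

(** For a block on the diagonal, positions and values are moved by the same injective map, in the
    block as well as outside it. *)
Lemma fixw_inflate t rho tau : t <= size tau ->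
  fixw (inflate t t rho tau) = fixw rho + fixw tau.
Proof.
move=> ht; rewrite /fixw size_inflate.
set r := size rho.
(* The positions are split into those before, inside and after the block. *)
have -> : r + size tau = t + (r + (size tau - t)) by lia.
rewrite !iotaD !count_cat add0n addnCA; congr (_ + _).
  have -> : iota t r = map (addn t) (iota 0 r) by rewrite -iotaDl addn0.
  rewrite count_map; apply: eq_in_count => y.
  by rewrite mem_iota /= => hy; rewrite nth_inflate_in // eqn_add2l.
have -> : iota 0 (size tau) = iota 0 t ++ iota t (size tau - t).
  by rewrite -{2}[t]add0n -iotaD subnKC.
rewrite count_cat; congr (_ + _).
  apply: eq_in_count => y; rewrite mem_iota /= => hy.
  have hs : shift t r y = y by rewrite /shift ifT.
  have := nth_inflate_out t rho ht (leq_trans hy ht).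
  by rewrite -/r hs => ->; rewrite -{2}hs (inj_eq (@shift_inj t r)).
rewrite addnC iotaDl count_map; apply: eq_in_count => y; rewrite mem_iota /= => hy.
have hs : shift t r y = r + y by rewrite /shift ifF; lia.
have hy' : y < size tau by lia.
have := nth_inflate_out t rho ht hy'; rewrite -/r hs => ->.
by rewrite -{1}hs (inj_eq (@shift_inj t r)).
Qed.

Lemma fixw_rcons sigma : fixw (rcons sigma (size sigma)) = (fixw sigma).+1.
Proof.
rewrite /fixw size_rcons -addn1 iotaD count_cat /= add0n nth_rcons ltnn !eqxx.
rewrite addn0 (addn1 (count _ _)); congr _.+1; apply: eq_in_count => y; rewrite mem_iota /= => hy.
by rewrite nth_rcons hy.
Qed.

Lemma inflate_inj t u rho tau rho' tau' :
  t <= size tau -> size rho = size rho' -> size tau = size tau' ->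
  inflate t u rho tau = inflate t u rho' tau' -> rho = rho' /\ tau = tau'.
Proof.
move=> ht sr st e; split; apply: (@eq_from_nth _ 0) => // y hy.
  have := nth_inflate_in u ht hy; rewrite e nth_inflate_in -?st -?sr //; lia.
have := nth_inflate_out u rho ht hy.
by rewrite e sr nth_inflate_out -?st // => /shift_inj.
Qed.

(** Conversely to [perm_word_inflate], any window of positions whose values lie in a window of equal
    length is a block that can be taken out. *)
Lemma inflate_decomp n w t u r : perm_word n w -> t + r <= n -> u + r <= n ->
  (forall x, t <= x < t + r -> u <= nth 0 w x < u + r) ->
  exists rho tau, [/\ w = inflate t u rho tau, perm_word r rho & perm_word (n - r) tau].
Proof.
move=> [sw bw iw] htr hur blk.
(* By pigeonhole the block uses up all values of its window, so every entry outside the block avoids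
   that window. *)
have surj v : u <= v < u + r -> exists2 x, t <= x < t + r & nth 0 w x = v.
  have -> : u + r = u + (t + r - t) by rewrite addKn.
  apply: interval_inj_surj => [x y hx hy | x /blk]; last by rewrite addKn.
  by apply: iw; lia.
have out x : x < n -> ~~ (t <= x < t + r) -> ~~ (u <= nth 0 w x < u + r).
  move=> hx; apply: contra => /surj[y hy /iw <-] //; lia.
exists (mkseq (fun y => nth 0 w (t + y) - u) r).
exists (mkseq (fun y => let v := nth 0 w (shift t r y) in
                        if v < u then v else v - r) (n - r)).
split.
- apply: (@eq_from_nth _ 0); first by rewrite size_inflate !size_mkseq; lia.
  rewrite sw => x hx.
  rewrite nth_mkseq !size_mkseq; last by lia.
  case: ifP => h1.
    rewrite nth_mkseq; last by lia.
    have hs : shift t r x = x by rewrite /shift h1.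
    have o : ~~ (u <= nth 0 w x < u + r) by apply: out => //; lia.
    rewrite hs /= /shift; move: o.
    by case: (ltnP (nth 0 w x) u) => h2 o; [rewrite h2 | rewrite ifF; lia].
  case: ifP => h2.
    rewrite nth_mkseq; last by lia.
    have e : t + (x - t) = x by lia.
    by rewrite e; have := blk x; lia.
  rewrite nth_mkseq; last by lia.
  have hs : shift t r (x - r) = x by rewrite /shift ifF; lia.
  have o : ~~ (u <= nth 0 w x < u + r) by apply: out => //; lia.
  rewrite hs /= /shift; move: o.
  by case: (ltnP (nth 0 w x) u) => h3 o; [rewrite h3 | rewrite ifF; lia].
- split; first by rewrite size_mkseq.
    by move=> x hx; rewrite nth_mkseq //; have := blk (t + x); lia.
  move=> x y hx hy; rewrite !nth_mkseq //.
  have := blk (t + x); have := blk (t + y); have := iw (t + x) (t + y); lia.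
- have hs x : x < n - r -> shift t r x < n /\ ~~ (t <= shift t r x < t + r).
    by rewrite /shift; case: ifP; lia.
  split; first by rewrite size_mkseq.
    move=> x hx; rewrite nth_mkseq //=; have [h1 h2] := hs x hx.
    by have := out _ h1 h2; have := bw _ h1; case: ifP; lia.
  move=> x y hx hy; rewrite !nth_mkseq //=.
  have [h1 h2] := hs x hx; have [h3 h4] := hs y hy.
  have := out _ h1 h2; have := bw _ h1; have := out _ h3 h4; have := bw _ h3.
  move=> a1 a2 a3 a4 e; apply: (@shift_inj t r); apply: iw => //.
  by move: e; case: ifP; case: ifP; lia.
Qed.

Lemma perm_word_surj n w v : perm_word n w -> v < n ->
  exists2 x, x < n & nth 0 w x = v.
Proof.
move=> [_ bw iw] hv.
have inj x y : 0 <= x < n -> 0 <= y < n -> nth 0 w x = nth 0 w y -> x = y.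
  exact: iw.
have bnd x : 0 <= x < n -> 0 <= nth 0 w x < 0 + (n - 0) by rewrite subn0; apply: bw.
by have [|x hx <-] := interval_inj_surj inj bnd (v := v); [rewrite subn0 | exists x].
Qed.

Lemma perm_word_rcons s sigma :
  perm_word s sigma <-> perm_word s.+1 (rcons sigma s) /\ size sigma = s.
Proof.
split=> [[ss bs is_]|[[_ bw iw] ss]].
  split=> //; split; first by rewrite size_rcons ss.
    move=> x hx; rewrite nth_rcons ss; case: ifP => hxs; last by case: ifP; lia.
    by have := bs x; lia.
  move=> x y hx hy; rewrite !nth_rcons ss.
  case: ltnP => hxs; case: ltnP => hys.
  - exact: is_.
  - by rewrite ifT; [have := bs x; lia | lia].
  - by rewrite ifT; [have := bs y; lia | lia].
  - lia.
have nr x : x < s -> nth 0 (rcons sigma s) x = nth 0 sigma x.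
  by move=> hx; rewrite nth_rcons ss hx.
have ns : nth 0 (rcons sigma s) s = s by rewrite nth_rcons ss ltnn eqxx.
split=> // [x hx | x y hx hy e].
  by have := bw x; have := iw x s; rewrite ns nr //; lia.
by apply: iw; rewrite ?nr //; lia.
Qed.

(** The equation [dF/dq = x F^2] in coefficients: the power [q^(f-1)] of an avoider with [f] fixed
    points is replaced by an arbitrary weight [g f]. *)
Definition marked_convolution P : Prop := forall (g : nat -> nat) n,
  \sum_(w <- Av P n.+1) fixw w * g (fixw w)
    = \sum_(s < n.+1) \sum_(sigma <- Av P s) \sum_(tau <- Av P (n - s))
        g (fixw sigma + fixw tau).+1.

(** * Splitting an avoider at a marked fixed point *)

Section PatternClass.
Variable P : nat -> nat -> nat -> bool.
Hypothesis P_mono : forall (f : nat -> nat) x y z,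
  {mono f : a b / a < b} -> P (f x) (f y) (f z) = P x y z.
Hypothesis P_last : forall x y z, P x y z -> z < y.

(** A new maximum in last position could only be the last entry of an occurrence, but by [P_last]
    that entry lies below the middle one. *)
Lemma pattern_free_rcons s sigma : perm_word s sigma ->
  pattern_free P (rcons sigma s) = pattern_free P sigma.
Proof.
move=> [ss bs _]; apply/pattern_freeP/pattern_freeP => H i j l hij hjl hl.
  have := H i j l hij hjl; rewrite size_rcons !nth_rcons hl.
  by rewrite (ltn_trans hjl hl) (ltn_trans hij (ltn_trans hjl hl)); apply; lia.
move: hl; rewrite size_rcons ltnS leq_eqVlt => /orP[/eqP hl|hl].
  apply/negP => /P_last; rewrite !nth_rcons hl ltnn eqxx ifT; last by lia.
  by have := bs j; lia.
have := H i j l hij hjl hl; rewrite !nth_rcons hl.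
by rewrite (ltn_trans hjl hl) (ltn_trans hij (ltn_trans hjl hl)).
Qed.

(** Both [rho] and [tau] are order-isomorphic to subwords of the inflation. *)
Lemma pattern_free_inflated t u rho tau : t <= size tau ->
  pattern_free P (inflate t u rho tau) -> pattern_free P rho /\ pattern_free P tau.
Proof.
move=> ht /pattern_freeP H; split; apply/pattern_freeP => i j l hij hjl hl.
  have := H (t + i) (t + j) (t + l).
  rewrite !nth_inflate_in ?size_inflate //; try lia.
  by rewrite (P_mono _ _ _ (ltn_add2l u)); apply; lia.
have := H (shift t (size rho) i) (shift t (size rho) j) (shift t (size rho) l).
rewrite !nth_inflate_out ?size_inflate //; try lia.
rewrite (P_mono _ _ _ (@shift_mono u _)) !shift_mono; apply => //.
by rewrite /shift; case: ifP; lia.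
Qed.

(* [cut tau] is the place of the diagonal at which a block ending in a fixed point
   may be inserted into [tau]. *)
Variable cut : seq nat -> nat.
Hypothesis cut_size : forall tau, cut tau <= size tau.
Hypothesis cut_free : forall r m (rho tau : seq nat), rho \in Av P r -> tau \in Av P m ->
  pattern_free P (inflate (cut tau) (cut tau) rho tau).
(** Each fixed point [i] ends a diagonal block from [t] to [i] whose removal leaves a word with cut
    [t]. This gives surjectivity of [glue]. *)
Hypothesis cut_exists : forall n (w : seq nat) i, w \in Av P n -> i < n -> nth 0 w i = i ->
  exists t, [/\ t <= i, forall x, t <= x <= i -> t <= nth 0 w x <= i
    & forall m (rho tau : seq nat), w = inflate t t rho tau -> size rho = i.+1 - t ->
        tau \in Av P m -> cut tau = t].
(** The word and the end of the block determine the cut; used in both directions, this gives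
    injectivity of [glue]. *)
Hypothesis cut_unique : forall m (rho tau : seq nat) m' (rho' tau' : seq nat),
  tau \in Av P m -> tau' \in Av P m' ->
  (forall y, y < size rho -> nth 0 rho y < size rho) ->
  (forall y, y < size rho' -> nth 0 rho' y < size rho') ->
  inflate (cut tau) (cut tau) rho tau = inflate (cut tau') (cut tau') rho' tau' ->
  cut tau + size rho = cut tau' + size rho' -> ~~ (cut tau < cut tau').

Let splits n : seq (seq nat * seq nat) :=
  flatten [seq [seq (sigma, tau) | sigma <- Av P s, tau <- Av P (n - s)]
          | s <- iota 0 n.+1].

Let marked n : seq (seq nat * nat) :=
  [seq (w, i) | w <- Av P n.+1, i <- [seq i <- iota 0 n.+1 | nth 0 w i == i]].

(** The bijection from [splits] to [marked]: [sigma] receives a final fixed point, the result is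
    inserted as a block at the cut of [tau], and the last position of the block is marked. *)
Let glue (st : seq nat * seq nat) : seq nat * nat :=
  (inflate (cut st.2) (cut st.2) (rcons st.1 (size st.1)) st.2, cut st.2 + size st.1).

Lemma mem_splits n (st : seq nat * seq nat) : st \in splits n <->
  [/\ size st.1 + size st.2 = n, st.1 \in Av P (size st.1)
    & st.2 \in Av P (size st.2)].
Proof.
have sz m w : w \in Av P m -> size w = m by case/mem_Av => /perm_word_size.
case: st => sigma tau /=; split.
  case/flattenP => _ /mapP[s + ->]; rewrite mem_iota => hs.
  case/allpairsP => -[? ?] /= [hsi hta [-> ->]].
  by rewrite (sz _ _ hsi) (sz _ _ hta) hsi hta; split=> //; lia.
move=> [hn hsi hta]; apply/flattenP.
exists [seq (x, y) | x <- Av P (size sigma), y <- Av P (n - size sigma)].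
  apply/mapP; exists (size sigma) => //.
  by rewrite mem_iota /= add0n ltnS -hn leq_addr.
apply/allpairsP; exists (sigma, tau); split=> //=.
by rewrite -hn addKn.
Qed.

Lemma splits_uniq n : uniq (splits n).
Proof.
rewrite /splits; have := iota_uniq 0 n.+1; elim: (iota _ _) => //= s r IH /andP[sr ur].
rewrite cat_uniq IH // andbT allpairs_uniq ?Av_uniq //=; last by case=> ? ? [].
apply/hasPn => -[sigma tau] /flattenP[_ /mapP[s' hs' ->]].
case/allpairsP => -[? ?] /= [/mem_Av[/perm_word_size sz _] _ [e _]].
apply/negP => /allpairsP[[? ?] /= [/mem_Av[/perm_word_size sz' _] _ [e' _]]].
by move: sr; rewrite -sz' -e' e sz hs'.
Qed.

Lemma marked_uniq n : uniq (marked n).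
Proof.
apply: allpairs_uniq_dep => [|w _|]; first exact: Av_uniq.
  by rewrite filter_uniq ?iota_uniq.
by move=> [x y] [x' y'] _ _ /= [-> ->].
Qed.

Lemma mem_marked n (wi : seq nat * nat) : wi \in marked n <->
  [/\ wi.1 \in Av P n.+1, wi.2 < n.+1 & nth 0 wi.1 wi.2 = wi.2].
Proof.
case: wi => w i /=; split.
  case/allpairsPdep => w' [i' [hw +  [-> ->]]].
  by rewrite mem_filter mem_iota => /andP[/eqP -> ?].
move=> [hw hi hf]; apply/allpairsPdep; exists w, i; split=> //.
by rewrite mem_filter mem_iota hf eqxx.
Qed.

Lemma AvE n (w : seq nat) : w \in Av P n -> [/\ size w = n, perm_word n w & pattern_free P w].
Proof. by move=> /mem_Av[pw fw]; split=> //; case: pw. Qed.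

Lemma Av_rcons s (sigma : seq nat) : sigma \in Av P s -> rcons sigma s \in Av P s.+1.
Proof.
move=> /mem_Av[ps fs]; apply/mem_Av; split; last by rewrite pattern_free_rcons.
by case/perm_word_rcons: ps.
Qed.

Lemma glue_marked n (st : seq nat * seq nat) : st \in splits n -> glue st \in marked n.
Proof.
case: st => sigma tau /mem_splits[/= <- hs ht]; apply/mem_marked => /=.
have hr := Av_rcons hs; have hc := cut_size tau.
have sr : size (rcons sigma (size sigma)) = (size sigma).+1 by rewrite size_rcons.
split; [apply/mem_Av; split | lia | ].
- rewrite -addSn; apply: perm_word_inflate => //; first by case/mem_Av: hr.
  by case/mem_Av: ht.
- exact: cut_free hr ht.
- by rewrite nth_inflate_in ?sr // nth_rcons ltnn eqxx.
Qed.

Lemma glue_inj n (st st' : seq nat * seq nat) :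
  st \in splits n -> st' \in splits n -> glue st = glue st' -> st = st'.
Proof.
case: st st' => [sigma tau] [sigma' tau'] /mem_splits[/= sz hs ht].
move=> /mem_splits[/= sz' hs' ht'] [e ec].
have b m (w : seq nat) : w \in Av P m -> forall y, y < size w -> nth 0 w y < size w.
  by case/AvE => -> [].
have br := b _ _ (Av_rcons hs); have br' := b _ _ (Av_rcons hs').
(* Comparing the two cuts both ways makes them equal; then the block sizes agree as well and
   [inflate_inj] applies. *)
have c1 := cut_unique ht ht' br br' e.
have c2 := cut_unique ht' ht br' br (esym e).
have ec2 : cut tau + size (rcons sigma (size sigma)) = cut tau' + size (rcons sigma' (size sigma')).
  by rewrite !size_rcons; lia.
have ct : cut tau = cut tau'.
  by have := c1 ec2; have := c2 (esym ec2); rewrite -!leqNgt; lia.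
rewrite ct in e.
have [|||/rcons_inj[-> _] ->] // := inflate_inj _ _ _ e.
- by rewrite -ct cut_size.
- by rewrite !size_rcons; lia.
- by lia.
Qed.

Lemma glue_surj n (wi : seq nat * nat) :
  wi \in marked n -> exists2 st : seq nat * seq nat, st \in splits n & glue st = wi.
Proof.
case: wi => w i /mem_marked[/= hw hi hf].
have [t [hti blk ct]] := cut_exists hw hi hf.
have [sw pw fw] := AvE hw.
have htr : t + (i.+1 - t) <= n.+1 by lia.
have blk' x : t <= x < t + (i.+1 - t) -> t <= nth 0 w x < t + (i.+1 - t).
  by have := blk x; lia.
have [rho [tau [ew pr pt]]] := inflate_decomp pw htr htr blk'.
have sr := perm_word_size pr; have st := perm_word_size pt.
have htau : t <= size tau by lia.
have [fr ft] : pattern_free P rho /\ pattern_free P tau.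
  by apply: (pattern_free_inflated (u := t) htau); rewrite -ew.
have ett : cut tau = t by apply: (ct _ _ _ ew sr); apply/mem_Av; split; [exact: pt | ].
move: ew pr sr fr; case/lastP: rho => [|sigma v] ew pr sr fr.
  by move: sr => /=; lia.
have ss : size sigma = i - t by move: sr; rewrite size_rcons; lia.
(* The marked point [i] is fixed in [w], so within the block the last entry is fixed too. *)
have ev : v = size sigma.
  have := hf; rewrite {1}ew -{1}(subnKC hti) nth_inflate_in //; last by rewrite sr; lia.
  by rewrite nth_rcons ss ltnn eqxx; lia.
have ps : perm_word (size sigma) sigma.
  by apply/perm_word_rcons; split=> //; rewrite -{2}ev (_ : (size sigma).+1 = i.+1 - t) //; lia.
exists (sigma, tau); last by rewrite /glue /= ett -ev -ew; congr (_, _); lia.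
apply/mem_splits => /=; split; first by lia.
  by apply/mem_Av; split=> //; rewrite -(pattern_free_rcons ps) -ev.
by apply/mem_Av; rewrite st.
Qed.

Lemma sum_marked : marked_convolution P.
Proof.
move=> g n.
(* The factor [fixw w] counts the choices of the marked fixed point; the sum is then reindexed along
   [glue]. *)
transitivity (\sum_(wi <- marked n) g (fixw wi.1)).
  rewrite big_allpairs_dep big_seq [RHS]big_seq; apply: eq_bigr => w /AvE[sw _ _].
  rewrite [RHS](eq_bigr (fun _ => g (fixw w))) // big_const_seq count_predT.
  by rewrite iter_addn_0 size_filter /fixw sw mulnC.
have -> : \sum_(wi <- marked n) g (fixw wi.1) = \sum_(st <- splits n) g (fixw (glue st).1).
  rewrite -(big_map glue predT (fun wi => g (fixw wi.1))); apply: perm_big.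
  apply: uniq_perm; first exact: marked_uniq.
    by rewrite map_inj_in_uniq ?splits_uniq //; apply: glue_inj.
  move=> wi; apply/idP/mapP => [/glue_surj[st hst <-] | [st hst ->]]; first by exists st.
  exact: glue_marked.
rewrite /splits big_flatten big_map -(big_mkord predT (fun s => \sum_(sigma <- Av P s) \sum_(tau <- Av P (n - s))
        g (fixw sigma + fixw tau).+1)).
rewrite /index_iota subn0; apply: eq_bigr => s _.
rewrite big_allpairs_dep; apply: eq_bigr => sigma _; apply: eq_bigr => tau _ /=.
by rewrite fixw_inflate ?cut_size // fixw_rcons addSn.
Qed.

End PatternClass.

(** * The patterns 321 and 132 *)

(** In this and the next predicate the third comparison follows by transitivity. *)
Definition p321 x y z := (y < x) && (z < y).
Definition p132 x y z := (x < z) && (z < y).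

Lemma p321_mono (f : nat -> nat) x y z :
  {mono f : a b / a < b} -> p321 (f x) (f y) (f z) = p321 x y z.
Proof. by move=> fm; rewrite /p321 !fm. Qed.

Lemma p132_mono (f : nat -> nat) x y z :
  {mono f : a b / a < b} -> p132 (f x) (f y) (f z) = p132 x y z.
Proof. by move=> fm; rewrite /p132 !fm. Qed.

Lemma p321_last x y z : p321 x y z -> z < y. Proof. by case/andP. Qed.

Lemma p132_last x y z : p132 x y z -> z < y. Proof. by case/andP. Qed.

(** With cut 0 the inflation is the direct sum of [rho] and [tau]. A decreasing triple cannot meet
    both summands, since [rho] lies before and below [tau]. *)
Lemma cut_free321 r m (rho tau : seq nat) : rho \in Av p321 r -> tau \in Av p321 m ->
  pattern_free p321 (inflate 0 0 rho tau).
Proof.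
move=> /AvE[sr [_ br _] /pattern_freeP fr] /AvE[st [_ bt _] /pattern_freeP ft].
have io y : y < size rho -> nth 0 (inflate 0 0 rho tau) y = nth 0 rho y.
  by move=> hy; have := nth_inflate_in 0 (leq0n (size tau)) hy.
have oo y : y < size tau ->
    nth 0 (inflate 0 0 rho tau) (y + size rho) = nth 0 tau y + size rho.
  by move=> hy; have := nth_inflate_out 0 rho (leq0n (size tau)) hy.
apply/pattern_freeP => i j l hij hjl; rewrite size_inflate => hl.
case: (ltnP l (size rho)) => hlr.
  by rewrite !io //; [exact: fr | lia | lia].
have [l' hl' el] : exists2 l', l' < size tau & l = l' + size rho.
  by exists (l - size rho); lia.
case: (ltnP j (size rho)) => hjr.
  by rewrite (io j) // el oo // /p321; have := br j; lia.
have [j' hj' ej] : exists2 j', j' < size tau & j = j' + size rho.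
  by exists (j - size rho); lia.
case: (ltnP i (size rho)) => hir.
  by rewrite (io i) // el ej !oo // /p321; have := br i; lia.
have [i' hi' ei] : exists2 i', i' < size tau & i = i' + size rho.
  by exists (i - size rho); lia.
rewrite ei ej el !oo //.
have := ft i' j' l'; rewrite /p321 !ltn_add2r; apply; lia.
Qed.

(** If some [x < i] had a value above [i], an entry below [i] behind [i] would complete a 321. Hence
    the positions from [i] on carry exactly the values from [i] on, including the value at [x], a
    contradiction. *)
Lemma cut_exists321 n (w : seq nat) i :
  w \in Av p321 n -> i < n -> nth 0 w i = i ->
  exists t, [/\ t <= i, forall x, t <= x <= i -> t <= nth 0 w x <= i
    & forall m (rho tau : seq nat), w = inflate t t rho tau -> size rho = i.+1 - t ->
        tau \in Av p321 m -> 0 = t].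
Proof.
move=> /AvE[sw [_ bw iw] /pattern_freeP fw] hi hf; exists 0; split=> // x /= hx.
rewrite leqNgt; apply/negP => hwx.
have hxi : x < i.
  have /eqP : x <> i by move=> ex; rewrite ex in hwx; lia.
  by lia.
have inj y z : i <= y < n -> i <= z < n -> nth 0 w y = nth 0 w z -> y = z.
  by move=> hy hz; apply: iw; lia.
have bnd y : i <= y < n -> i <= nth 0 w y < i + (n - i).
  move=> hy; have := bw y; rewrite leqNgt.
  case: (ltnP (nth 0 w y) i) => hyi /=; last by lia.
  have /eqP hiy : i <> y by move=> ey; rewrite -ey in hyi; lia.
  by have := fw x i y hxi; rewrite sw /p321 hf; lia.
have [|y hy e] := interval_inj_surj inj bnd (v := nth 0 w x).
  by have := bw x; lia.
by have := iw y x; lia.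
Qed.

(* The largest [t] such that the first [t] entries of [tau] are all at least [t]. *)
Definition cut132 (tau : seq nat) : nat :=
  find (fun t => has (fun v => v <= t) (take t.+1 tau)) (iota 0 (size tau)).

Lemma cut132_size tau : cut132 tau <= size tau.
Proof. by rewrite -[X in _ <= X](size_iota 0) find_size. Qed.

Lemma cut132_ge tau x : x < cut132 tau -> cut132 tau <= nth 0 tau x.
Proof.
move=> hx; have hs := cut132_size tau.
have [t et] : exists t, cut132 tau = t.+1 by exists (cut132 tau).-1; lia.
have := @before_find _ 0 (fun t => has (fun v => v <= t) (take t.+1 tau)) (iota 0 (size tau)) t.
rewrite -/(cut132 tau) et ltnSn => /(_ isT).
rewrite nth_iota ?add0n; last by lia.
move/hasPn/(_ (nth 0 tau x)); rewrite -ltnNge; apply.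
by rewrite -(@nth_take t.+1) -et // mem_nth // size_takel.
Qed.

Lemma cut132_stop tau : cut132 tau < size tau ->
  exists2 x, x <= cut132 tau & nth 0 tau x <= cut132 tau.
Proof.
move=> hc.
have := @nth_find _ 0 (fun t => has (fun v => v <= t) (take t.+1 tau)) (iota 0 (size tau)).
rewrite has_find size_iota => /(_ hc).
rewrite -/(cut132 tau) nth_iota // add0n => /(has_nthP 0)[x].
rewrite size_takel // => hx; rewrite nth_take // => h.
by exists x.
Qed.

(** If the first [t] entries are all at least [t], the same holds for every smaller [t], so the
    place where this stops is unique. *)
Lemma cut132_eq t tau : t <= size tau -> (forall x, x < t -> t <= nth 0 tau x) ->
  (t < size tau -> exists2 x, x <= t & nth 0 tau x <= t) -> cut132 tau = t.
Proof.
move=> hs hge hstop; case: (ltngtP (cut132 tau) t) => // hlt; exfalso.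
  have [|x hx hv] := @cut132_stop tau; first exact: leq_trans hlt hs.
  by have := hge x; lia.
have [|x hx hv] := hstop; first exact: leq_trans hlt (cut132_size tau).
by have := cut132_ge (leq_ltn_trans hx hlt); lia.
Qed.

(** A descent to the right of and above the cut would form a 132 with the small early entry given by
    [cut132_stop]. *)
Lemma cut132_increasing m tau a b : tau \in Av p132 m -> a < b -> b < m ->
  cut132 tau <= a -> cut132 tau <= nth 0 tau b -> nth 0 tau a <= nth 0 tau b.
Proof.
move=> /AvE[st [_ bt it] /pattern_freeP ft] hab hb ha hv.
rewrite leqNgt; apply/negP => hlt.
have [|x hx hxv] := @cut132_stop tau; first by lia.
case: (ltngtP x a) => hxa; [| lia | by rewrite hxa in hxv; lia].
have := ft x a b hxa hab; rewrite /p132 st hb hlt andbT -leqNgt => /(_ isT) hle.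
by have := it x b; lia.
Qed.

(** Entries before the block lie above it by [cut132_ge], so an occurrence only partly in the block
    would start there. Its other two entries would be a descent to the right of and above the block,
    against [cut132_increasing]. *)
Lemma cut_free132 r m (rho tau : seq nat) : rho \in Av p132 r -> tau \in Av p132 m ->
  pattern_free p132 (inflate (cut132 tau) (cut132 tau) rho tau).
Proof.
move=> /AvE[sr [_ br _] /pattern_freeP fr] htau.
have [st [_ bt _] /pattern_freeP ft] := AvE htau.
have cge := @cut132_ge tau; have cinc := cut132_increasing htau.
set t := cut132 tau in cge cinc *.
have ht : t <= size tau := cut132_size tau.
apply/pattern_freeP => i j l hij hjl; rewrite size_inflate => hl.
have hj : j < size rho + size tau by lia.
have hi : i < size rho + size tau by lia.
case: (inflateP ht hi) hij => i' hi' ->; case: (inflateP ht hj) hjl => j' hj' ->;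
  case: (inflateP ht hl) => l' hl' ->; move=> hjl hij;
  rewrite ?nth_inflate_in ?nth_inflate_out //.
(* Eight cases, according to which of [i], [j], [l] lie in the block, from all three to none. *)
- by rewrite (p132_mono _ _ _ (ltn_add2l t)); apply: fr; lia.
- rewrite /p132 /shift; have := br i'; have := br j'; case: ifP; lia.
- by exfalso; move: hij hjl; rewrite /shift; case: ifP; lia.
- have hj't : t <= j' by move: hij; rewrite /shift; case: ifP; lia.
  have hjl' : j' < l' by move: hjl; rewrite shift_mono.
  rewrite /p132 shift_mono; apply/negP => /andP[h1 h2].
  have hlt : t <= nth 0 tau l' by move: h1; rewrite /shift; case: ifP; lia.
  by have := cinc j' l' hjl'; rewrite -st; lia.
- have hi't : i' < t by move: hij; rewrite /shift; case: ifP; lia.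
  rewrite /p132 /shift; have := cge _ hi't; have := br j'; case: ifP; lia.
- have hi't : i' < t by move: hij; rewrite /shift; case: ifP; lia.
  have := cge _ hi't => h; rewrite /p132 {1}/shift ifF; last by lia.
  by have := br j'; lia.
- have hi't : i' < t by move: hij hjl; rewrite shift_mono /shift; case: ifP; lia.
  have := cge _ hi't => h; rewrite /p132 {1}/shift ifF; last by lia.
  by have := br l'; lia.
- rewrite (p132_mono _ _ _ (@shift_mono t _)).
  by apply: ft => //; [move: hij | move: hjl]; rewrite shift_mono.
Qed.

Lemma cut_exists132 n (w : seq nat) i :
  w \in Av p132 n -> i < n -> nth 0 w i = i ->
  exists t, [/\ t <= i, forall x, t <= x <= i -> t <= nth 0 w x <= i
    & forall m (rho tau : seq nat), w = inflate t t rho tau -> size rho = i.+1 - t ->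
        tau \in Av p132 m -> cut132 tau = t].
Proof.
move=> hw hi hf; have [sw pw /pattern_freeP fw] := AvE hw; have [_ bw iw] := pw.
have ex : exists x, nth 0 w x <= i by exists i; rewrite hf.
(* The block starts at the first position whose value is at most [i]. *)
case: (ex_minnP ex) => t ht tmin; exists t.
have hti : t <= i by apply: tmin; rewrite hf.
have up x : t <= x <= i -> nth 0 w x <= i.
  (* A value above [i] between the positions [t] and [i] would form a 132 with the entries at [t]
     and [i]. *)
  move=> hx; rewrite leqNgt; apply/negP => hlt.
  have /eqP htx' : t <> x by move=> ex'; rewrite ex' in ht; lia.
  have htx : t < x by lia.
  have /eqP hxi' : x <> i by move=> ex'; rewrite ex' in hlt; lia.
  have hxi : x < i by lia.
  have := fw t x i htx hxi; rewrite sw /p132 hf hlt andbT => /(_ hi).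
  by have := iw t i; lia.
split=> // [x hx | m rho tau ew sr htau].
  rewrite (up x hx) andbT; case: (ltngtP x i) => hxi; [| lia | by rewrite hxi hf].
  have inw v : v < n -> v \in w.
    by case/(perm_word_surj pw) => y hy <-; rewrite mem_nth ?sw.
  (* The values from [w_x] to [i] can only occur in positions from [t] to [i]. *)
  suff : i.+1 - nth 0 w x <= i.+1 - t by have := up x hx; lia.
  apply: (@interval_inj_leq (fun v => index v w)) => [u v hu hv e | v hv].
    by rewrite -(nth_index 0 (inw u _)) ?e ?nth_index ?inw //; lia.
  have hvn : v < n by lia.
  have := nth_index 0 (inw v hvn); have := inw v hvn; rewrite -index_mem sw.
  set y := index v w => hy ey0; have ey : nth 0 w y = v := ey0.
  have hty : t <= y by apply: tmin; rewrite ey; lia.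
  rewrite hty /= ltnS leqNgt; apply/negP => hiy.
  have hvi : v != i by apply/negP => /eqP evi; have := iw y i; lia.
  have /eqP hvx : v <> nth 0 w x.
    by move=> evi; have := iw y x; lia.
  by have := fw x i y hxi hiy; rewrite sw /p132 hf ey; lia.
have [st ptau _] := AvE htau; have [_ bt it] := ptau.
have sn : n = size rho + size tau by rewrite -sw ew size_inflate.
have hts : t <= size tau by lia.
(* Entries of [w] before [t] exceed [i] by minimality of [t], so they remain at least [t] once the
   block is removed. *)
apply: cut132_eq => // [x hx | hlt].
  rewrite leqNgt; apply/negP => hxv.
  have : ~~ (nth 0 w x <= i) by apply/negP => /tmin; lia.
  have hs : shift t (size rho) x = x by rewrite /shift hx.
  have := nth_inflate_out t rho hts (leq_trans hx hts).
  by rewrite -ew hs /shift hxv => ->; lia.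
case: (leqP (nth 0 tau t) t) => htt; first by exists t.
(* If the entry of [tau] at [t] exceeds [t], the position [p] of the value [t] is the witness. With
   [p > t], the word [w] would contain a 132: the value [i], then at position [i + 1] a value above
   [i + 1], then [i + 1]. *)
have [p hp ep] : exists2 p, p < m & nth 0 tau p = t by apply: perm_word_surj ptau _; lia.
exists p; last by rewrite ep.
rewrite leqNgt; apply/negP => htp.
have := nth_inflate_out t rho hts hlt; rewrite -ew.
have -> : shift t (size rho) t = i.+1 by rewrite /shift ltnn sr; lia.
rewrite {1}/shift ifF; last by lia.
have hp' : p < size tau by lia.
have := nth_inflate_out t rho hts hp'; rewrite -ew ep.
rewrite {1 2}/shift ltnn ifF; last by lia.
move=> e1 e2; have := fw i i.+1 (p + size rho) (ltnSn _).
by rewrite /p132 hf e1 e2; lia.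
Qed.

(** If the first cut were smaller, the entry at that position would lie in the first block, hence
    below the common end of the blocks. It would also lie to the left of the second block, hence at
    or above that end. *)
Lemma cut_unique132 m (rho tau : seq nat) m' (rho' tau' : seq nat) :
  tau \in Av p132 m -> tau' \in Av p132 m' ->
  (forall y, y < size rho -> nth 0 rho y < size rho) ->
  (forall y, y < size rho' -> nth 0 rho' y < size rho') ->
  inflate (cut132 tau) (cut132 tau) rho tau
    = inflate (cut132 tau') (cut132 tau') rho' tau' ->
  cut132 tau + size rho = cut132 tau' + size rho' -> ~~ (cut132 tau < cut132 tau').
Proof.
move=> _ _ br _ e es; apply/negP => hlt.
have hr : 0 < size rho by lia.
have := nth_inflate_in (cut132 tau) (cut132_size tau) hr; rewrite addn0 e.
have ht' := cut132_size tau'.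
have := nth_inflate_out (cut132 tau') rho' ht' (leq_trans hlt ht').
rewrite {1}/shift hlt => ->; rewrite /shift ifF; last first.
  by have := cut132_ge hlt; lia.
by have := br 0 hr; have := cut132_ge hlt; lia.
Qed.

Lemma sum_marked321 : marked_convolution p321.
Proof.
(* Here all cuts are 0, so [cut_unique] reduces to the falsity of [0 < 0]. *)
exact: (sum_marked p321_mono p321_last (cut := fun=> 0) (fun=> leq0n _)
  cut_free321 cut_exists321).
Qed.

Lemma sum_marked132 : marked_convolution p132.
Proof.
exact: (sum_marked p132_mono p132_last cut132_size
  cut_free132 cut_exists132 cut_unique132).
Qed.

(** * Counting avoiders by insertion *)

(** Membership of [x] in the last [l] positions is written [size w <= x + l] to avoid truncated
    subtraction. *)
Definition increasing_end l (w : seq nat) : bool :=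
  (l <= size w) && all (fun y => all (fun x =>
    (size w <= x + l) ==> (nth 0 w x < nth 0 w y)) (iota 0 y)) (iota 0 (size w)).

Lemma increasing_endP l (w : seq nat) :
  reflect (l <= size w /\
           forall x y, size w <= x + l -> x < y -> y < size w -> nth 0 w x < nth 0 w y)
          (increasing_end l w).
Proof.
apply: (iffP andP) => -[hl H]; split=> //.
  move=> x y hx hxy hy.
  have io a b : a < b -> a \in iota 0 b by rewrite mem_iota.
  by have /allP/(_ _ (io _ _ hxy))/implyP/(_ hx) := allP H y (io _ _ hy).
apply/allP => y; rewrite mem_iota => hy; apply/allP => x; rewrite mem_iota => hxy.
by apply/implyP => hx; apply: H.
Qed.

Lemma increasing_end0 w : increasing_end 0 w.
Proof. by apply/increasing_endP; split=> // x y; rewrite addn0; lia. Qed.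

Definition insert p v (w : seq nat) := inflate p v [:: 0] w.

Lemma nth_insert_at p v w : p <= size w -> nth 0 (insert p v w) p = v.
Proof.
by move=> hp; have := nth_inflate_in v hp (ltn0Sn 0 : 0 < size [:: 0]); rewrite !addn0.
Qed.

Lemma nth_insert_lt p v w x : p <= size w -> x < p ->
  nth 0 (insert p v w) x = shift v 1 (nth 0 w x).
Proof.
move=> hp hx; have := nth_inflate_out v [:: 0] hp (leq_trans hx hp).
by rewrite {1}/shift hx.
Qed.

Lemma nth_insert_ge p v w x : p <= size w -> p <= x -> x < size w ->
  nth 0 (insert p v w) x.+1 = shift v 1 (nth 0 w x).
Proof.
move=> hp hpx hx; have := nth_inflate_out v [:: 0] hp hx.
by rewrite {1}/shift ltnNge hpx addn1.
Qed.

Lemma size_insert p v w : size (insert p v w) = (size w).+1.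
Proof. by rewrite size_inflate. Qed.

Section InsertionCount.
Variable P : nat -> nat -> nat -> bool.
Hypothesis P_mono : forall (f : nat -> nat) x y z,
  {mono f : a b / a < b} -> P (f x) (f y) (f z) = P x y z.
Variable newv : nat -> nat.
Hypothesis newv_leq : forall n, newv n <= n.

Let ins (wj : seq nat * nat) :=
  insert (size wj.1 - wj.2) (newv (size wj.1)) wj.1.

(** The new entry [newv n] goes in front of the last [j] entries, and the allowed places are those
    followed by an increasing segment. *)
Hypothesis insert_free : forall n (w : seq nat) j, w \in Av P n -> j <= n ->
  pattern_free P (insert (n - j) (newv n) w) = increasing_end j w.
(** The rule of the Catalan generating tree: if the longest increasing end of [w] has length [L],
    those of its [L + 1] children have the lengths [1, ..., L + 1] in some order. *)
Hypothesis insert_end : forall n (w : seq nat) l, w \in Av P n ->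
  \sum_(j < n.+1 | increasing_end j w) increasing_end l.+1 (insert (n - j) (newv n) w)
    = \sum_(j < n.+1 | l <= j) increasing_end j w.

Let sites n : seq (seq nat * nat) :=
  [seq (w, j) | w <- Av P n, j <- [seq j <- iota 0 n.+1 | increasing_end j w]].

Lemma mem_sites n (wj : seq nat * nat) : wj \in sites n <->
  [/\ wj.1 \in Av P n, wj.2 <= n & increasing_end wj.2 wj.1].
Proof.
case: wj => w j /=; split.
  case/allpairsPdep => w' [j' [hw +  [-> ->]]].
  by rewrite mem_filter mem_iota => /andP[-> ?].
move=> [hw hi hf]; apply/allpairsPdep; exists w, j; split=> //.
by rewrite mem_filter mem_iota hf.
Qed.

Lemma sites_uniq n : uniq (sites n).
Proof.
apply: allpairs_uniq_dep => [|w _|]; first exact: Av_uniq.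
  by rewrite filter_uniq ?iota_uniq.
by move=> [x y] [x' y'] _ _ /= [-> ->].
Qed.

Lemma ins_Av n (wj : seq nat * nat) : wj \in sites n -> ins wj \in Av P n.+1.
Proof.
case: wj => w j /mem_sites[/= hw hj hf]; have [sw pw fw] := AvE hw.
rewrite /ins /= sw; apply/mem_Av; split; last by rewrite insert_free.
rewrite -add1n; apply: perm_word_inflate => //; first exact: leq_subr.
by split=> // [[|//] _ | [|//] [|//]].
Qed.

Lemma ins_inj n (wj wj' : seq nat * nat) :
  wj \in sites n -> wj' \in sites n -> ins wj = ins wj' -> wj = wj'.
Proof.
move=> hwj hwj'; have [_ [_ _ iw] _] := AvE (ins_Av hwj).
case: wj hwj iw => w j /mem_sites[/= hw hj _].
case: wj' hwj' => w' j' /mem_sites[/= hw' hj' _].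
have [sw _ _] := AvE hw; have [sw' _ _] := AvE hw'.
rewrite /ins /= sw sw' => iw e.
have lj : n - j <= n by apply: leq_subr.
have lj' : n - j' <= n by apply: leq_subr.
have ep : n - j = n - j'.
  apply: iw; rewrite ?ltnS // nth_insert_at ?sw // e nth_insert_at ?sw' //.
rewrite ep in e.
have [|||_ ->] // := inflate_inj _ _ _ e; rewrite ?sw ?sw' //.
by congr (_, _); lia.
Qed.

Lemma ins_surj n (w : seq nat) : w \in Av P n.+1 ->
  exists2 wj : seq nat * nat, wj \in sites n & ins wj = w.
Proof.
move=> /AvE[sw pw fw].
have [p hp ep] : exists2 p, p < n.+1 & nth 0 w p = newv n.
  by apply: perm_word_surj pw _; rewrite ltnS newv_leq.
have [|||rho [tau [ew [sr br _] pt]]] := @inflate_decomp n.+1 w p (newv n) 1 pw.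
- by rewrite addn1.
- by rewrite addn1 ltnS newv_leq.
- by move=> x hx; rewrite (_ : x = p) ?ep; lia.
rewrite subn1 /= in pt; have st := perm_word_size pt.
have er : rho = [:: 0].
  by case: rho sr br {ew} => [|a [|b r]] //= _ /(_ 0 isT) /=; case: a.
have hps : p <= size tau by rewrite st; lia.
have ft : pattern_free P tau.
  by have [] := @pattern_free_inflated P P_mono p (newv n) rho tau hps; rewrite -?ew.
have htau : tau \in Av P n by apply/mem_Av.
rewrite er -/(insert _ _ _) in ew.
have epp : n - (n - p) = p by lia.
exists (tau, n - p); last by rewrite /ins /= st epp ew.
apply/mem_sites; split=> //=; first by lia.
by rewrite -(insert_free htau) ?leq_subr // epp -ew.
Qed.

Lemma sum_insert (g : seq nat -> nat) n :
  \sum_(w <- Av P n.+1) g w = \sum_(w <- Av P n) \sum_(j < n.+1 | increasing_end j w)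
    g (insert (n - j) (newv n) w).
Proof.
transitivity (\sum_(wj <- sites n) g (ins wj)).
  rewrite -(big_map ins predT g); apply: perm_big.
  apply: uniq_perm; first exact: Av_uniq.
    by rewrite map_inj_in_uniq ?sites_uniq //; apply: ins_inj.
  move=> w; apply/idP/mapP => [/ins_surj[wj hwj <-] | [wj hwj ->]]; first by exists wj.
  exact: ins_Av.
rewrite big_allpairs_dep big_seq [RHS]big_seq; apply: eq_bigr => w /AvE[sw _ _].
rewrite big_filter -(big_mkord (fun j => increasing_end j w) (fun j => g (insert (n - j) (newv n) w))).
by rewrite /index_iota subn0; apply: eq_bigr => j _; rewrite /ins /= sw.
Qed.

Lemma sum_ballot n l : \sum_(j < n.+1 | l <= j) ballot n j = ballot n.+1 l.+1.
Proof.
(* Downward induction on [l] with measure [d]: the term [j = l] is split off, as in [ballotSS]. *)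
have [d hd] : exists d, n.+1 <= l + d by exists n.+1; lia.
elim: d l hd => [|d IH] l hd.
  by rewrite ballot_gt ?big1 // => [j|]; first (have := ltn_ord j; lia); lia.
case: (leqP l n) => hln; last first.
  by rewrite ballot_gt ?big1 // => j; have := ltn_ord j; lia.
rewrite ballotSS -(IH l.+1); last by lia.
rewrite (bigD1 (Ordinal (hln : l < n.+1))) //=; congr (_ + _); apply: eq_bigl => j.
by rewrite -val_eqE /=; lia.
Qed.

(** Summing [insert_end] over all avoiders of size [n] yields the recursion [sum_ballot]. *)
Lemma count_increasing_end n l :
  \sum_(w <- Av P n) increasing_end l w = ballot n l.
Proof.
elim: n l => [|n IH] l.
  have -> : Av P 0 = [:: [::]] by [].
  rewrite big_seq1; case: l => [|l]; first by rewrite increasing_end0.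
  by rewrite ballot_gt.
have sumE k : \sum_(w <- Av P n) \sum_(j < n.+1 | k <= j) increasing_end j w = ballot n.+1 k.+1.
  by rewrite exchange_big -sum_ballot; apply: eq_bigr => j _; apply: IH.
rewrite sum_insert big_seq; case: l => [|l].
  (* For [l = 0] every child counts, so the total is the number of all sites. *)
  rewrite ballotS0 -sumE [RHS]big_seq; apply: eq_bigr => w _.
  rewrite big_mkcond /=; apply: eq_bigr => j _.
  by rewrite increasing_end0; case: increasing_end.
by rewrite -sumE [RHS]big_seq; apply: eq_bigr => w /insert_end ->.
Qed.

Lemma size_Av n : size (Av P n) = ballot n 0.
Proof.
rewrite -count_increasing_end -sum1_size.
by apply: eq_bigr => w _; rewrite increasing_end0.
Qed.

End InsertionCount.

(** A new minimum can only be the first entry of a 132, which it completes exactly when a descent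
    follows it. *)
Lemma insert_free132 n (w : seq nat) j : w \in Av p132 n -> j <= n ->
  pattern_free p132 (insert (n - j) 0 w) = increasing_end j w.
Proof.
move=> /AvE[sw [_ bw iw] /pattern_freeP fw] hj.
have hp : n - j <= size w by rewrite sw leq_subr.
apply/pattern_freeP/increasing_endP => [H | [_ H]].
  split=> [|x y hx hxy hy]; first by rewrite sw.
  have hpx : n - j <= x by lia.
  have := H (n - j) x.+1 y.+1 hpx hxy.
  rewrite size_insert ltnS nth_insert_at // !nth_insert_ge //; try lia.
  rewrite /shift /= => /(_ hy); have := iw x y; rewrite /p132; lia.
move=> x y z hxy hyz; rewrite size_insert => hz.
have hx' : x < 1 + size w by lia.
have hy' : y < 1 + size w by lia.
case: (inflateP (rho := [:: 0]) hp hx') hxy => [[|//] _|x' hx] ->;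
  case: (inflateP (rho := [:: 0]) hp hy') hyz => [[|//] _|y' hy] ->;
  case: (inflateP (rho := [:: 0]) hp hz) => [[|//] _|z' hz'] ->;
  rewrite ?addn0 ?nth_insert_at ?nth_inflate_out //; try lia; move=> hyz hxy; rewrite /p132 ?ltn0 ?andbF //.
  have hpy : n - j <= y' by move: hxy; rewrite /shift; case: ifP; lia.
  have hyz' : y' < z' by move: hyz; rewrite shift_mono.
  have := H y' z'; rewrite shift_mono; lia.
rewrite !shift_mono; apply: fw => //.
- by move: hxy; rewrite shift_mono.
- by move: hyz; rewrite shift_mono.
Qed.

(** The new minimum extends the increasing end behind it to length [j + 1] and no further, as the
    entry before it is larger. *)
Lemma insert_end132 n (w : seq nat) l : w \in Av p132 n ->
  \sum_(j < n.+1 | increasing_end j w) increasing_end l.+1 (insert (n - j) 0 w)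
    = \sum_(j < n.+1 | l <= j) increasing_end j w.
Proof.
move=> /AvE[sw [_ bw iw] _]; rewrite big_mkcond [RHS]big_mkcond.
apply: eq_bigr => j _; case: increasing_endP => [[hj H]|_]; last by case: ifP.
have hp : n - j <= size w by rewrite sw leq_subr.
have -> : increasing_end l.+1 (insert (n - j) 0 w) = (l <= j); last by case: leqP.
case: (leqP l j) => hlj.
  apply/increasing_endP; rewrite size_insert; split; first by lia.
  move=> x [//|y] hx hxy hy.
  have hpy : n - j <= y by lia.
  rewrite [X in _ < X]nth_insert_ge // /shift /=.
  have [->|/eqP hxp] := eqVneq x (n - j); first by rewrite nth_insert_at // addn1.
  case: x hx hxy hxp => [|x] hx hxy hxp; first by lia.
  by rewrite nth_insert_ge ?/shift /= ?ltn_add2r; [apply: H | | |]; lia.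
apply/negbTE/negP => /increasing_endP; rewrite size_insert => -[hl K].
have hlt : n - j < (size w).+1 by lia.
have := K (n - j).-1 (n - j); rewrite nth_insert_at // ltn0 => K'.
by suff : false by []; apply: K'; lia.
Qed.

(** A new maximum can only be the first entry of a 321, which it completes exactly when a descent
    follows it. *)
Lemma insert_free321 n (w : seq nat) j : w \in Av p321 n -> j <= n ->
  pattern_free p321 (insert (n - j) n w) = increasing_end j w.
Proof.
move=> /AvE[sw [_ bw iw] /pattern_freeP fw] hj.
have hp : n - j <= size w by rewrite sw leq_subr.
have sh x : x < size w -> shift n 1 (nth 0 w x) = nth 0 w x.
  by rewrite sw /shift => /bw ->.
apply/pattern_freeP/increasing_endP => [H | [_ H]].
  split=> [|x y hx hxy hy]; first by rewrite sw.
  have hpx : n - j <= x by lia.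
  have := H (n - j) x.+1 y.+1 hpx hxy.
  rewrite size_insert ltnS nth_insert_at // !nth_insert_ge ?sh //; try lia.
  move=> /(_ hy); have := iw x y; have := bw x; rewrite /p321; lia.
move=> x y z hxy hyz; rewrite size_insert => hz.
have hx' : x < 1 + size w by lia.
have hy' : y < 1 + size w by lia.
case: (inflateP (rho := [:: 0]) hp hx') hxy => [[|//] _|x' hx] ->;
  case: (inflateP (rho := [:: 0]) hp hy') hyz => [[|//] _|y' hy] ->;
  case: (inflateP (rho := [:: 0]) hp hz) => [[|//] _|z' hz'] ->;
  rewrite ?addn0 ?nth_insert_at ?nth_inflate_out ?sh //; try lia; move=> hyz hxy; rewrite /p321.
- have hpy : n - j <= y' by move: hxy; rewrite /shift; case: ifP; lia.
  have hyz' : y' < z' by move: hyz; rewrite shift_mono.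
  have := H y' z'; lia.
- by have := bw x'; lia.
- by have := bw y'; lia.
apply: fw => //.
- by move: hxy; rewrite shift_mono.
- by move: hyz; rewrite shift_mono.
Qed.

(** A new maximum at the very end ([j = 0]) lengthens the longest increasing end by one; for [j > 0]
    it is followed by a descent, and the longest increasing end has length [j]. *)
Lemma insert_end321 n (w : seq nat) l : w \in Av p321 n ->
  \sum_(j < n.+1 | increasing_end j w) increasing_end l.+1 (insert (n - j) n w)
    = \sum_(j < n.+1 | l <= j) increasing_end j w.
Proof.
move=> /AvE[sw [_ bw iw] _].
have sh x : x < size w -> shift n 1 (nth 0 w x) = nth 0 w x.
  by rewrite sw /shift => /bw ->.
have e0 : increasing_end l.+1 (insert n n w) = increasing_end l w.
  have hp : n <= size w by rewrite sw.
  apply/increasing_endP/increasing_endP; rewrite size_insert => -[hl H]; split=> // x y hx hxy hy.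
    by have := H x y; rewrite !nth_insert_lt ?sh //; lia.
  have hxn : x < n by lia.
  rewrite nth_insert_lt ?sh //; try lia.
  have [->|/eqP hyn] := eqVneq y n; first by rewrite nth_insert_at ?bw.
  by rewrite nth_insert_lt ?sh //; [apply: H | |]; lia.
have eS (j : nat) : 0 < j -> increasing_end j w ->
    increasing_end l.+1 (insert (n - j) n w) = (l < j).
  move=> j0 /increasing_endP[hj H].
  have hp : n - j <= size w by rewrite sw leq_subr.
  apply/increasing_endP/idP => [|hlj]; rewrite size_insert.
    move=> [hl K]; rewrite ltnNge; apply/negP => hjl.
    have := K (n - j) (n - j).+1; rewrite nth_insert_at // nth_insert_ge ?sh //; try lia.
    by have := bw (n - j); lia.
  split; first by lia.
  move=> [|x] [//|y] hx hxy hy; first by lia.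
  by rewrite !nth_insert_ge ?sh //; try lia; apply: H; lia.
rewrite (bigD1 ord0) /= ?increasing_end0 // subn0 e0.
case: (leqP l n) => hln; last first.
  rewrite [RHS]big1 => [|j]; last by have := ltn_ord j; lia.
  rewrite big1 => [|j /andP[hj hj0]].
    by case: increasing_endP => // -[]; lia.
  rewrite eS ?lt0n //; by have := ltn_ord j; lia.
(* The term [j = 0] on the left is matched with [j = l] on the right; the remaining terms agree for
   each [j]. *)
rewrite [RHS](bigD1 (Ordinal (hln : l < n.+1))) //=; congr (_ + _).
rewrite big_mkcond [RHS]big_mkcond; apply: eq_bigr => j _ /=.
rewrite -!val_eqE /=; case: ifP => [/andP[hj hj0]|hj].
  by rewrite eS ?lt0n // hj; case: ifP; lia.
by case: ifP => // hlj; case: increasing_end hj => //; lia.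
Qed.

Lemma size_Av132 n : size (Av p132 n) = ballot n 0.
Proof. exact: (size_Av p132_mono (fun n => leq0n n) insert_free132 insert_end132). Qed.

Lemma size_Av321 n : size (Av p321 n) = ballot n 0.
Proof. exact: (size_Av p321_mono (fun n => leqnn n) insert_free321 insert_end321). Qed.

(** * Moments and inversion *)

(** The statement [M n k = C_n^(k)], by strong induction on the size: marking one of [k + 1] chosen
    fixed points splits the avoider and distributes the other [k] over the two parts. *)
Lemma marked_moments P :
  marked_convolution P ->
  (forall n, size (Av P n) = ballot n 0) ->
  forall n k, \sum_(w <- Av P n) 'C(fixw w, k) = ballot n k.
Proof.
move=> markedE sizeE; elim/ltn_ind => n IH [|k].
  by rewrite -sizeE -sum1_size; apply: eq_bigr => w _; rewrite bin0.
case: n IH => [|n] IH.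
  have -> : Av P 0 = [:: [::]] by [].
  by rewrite big_seq1 ballot_gt.
apply/eqP; rewrite -(eqn_pmul2l (ltn0Sn k)); apply/eqP.
transitivity (\sum_(w <- Av P n.+1) fixw w * 'C((fixw w).-1, k)).
  rewrite big_distrr; apply: eq_bigr => w _ /=.
  by case: (fixw w) => [|f]; [rewrite muln0 | rewrite -mul_bin_diag].
(* With this weight the right-hand side contains the binomials of [fixw sigma + fixw tau] over [k],
   which Vandermonde's identity expands. *)
rewrite (markedE (fun f => 'C(f.-1, k))).
transitivity (\sum_(s < n.+1) \sum_(i < k.+1) ballot s i * ballot (n - s) (k - i)).
  apply: eq_bigr => s _.
  under eq_bigr => sigma _ do under eq_bigr => tau _ do rewrite /= -binomial.Vandermonde.
  under eq_bigr => sigma _ do rewrite exchange_big.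
  rewrite exchange_big; apply: eq_bigr => i _.
  rewrite -(IH s) ?ltn_ord // -(IH (n - s)); last by rewrite ltnS leq_subr.
  by rewrite big_distrl; apply: eq_bigr => sigma _; rewrite big_distrr.
(* By [ballot_conv] each of the [k + 1] values of [i] contributes the same, which accounts for the
   factor [k.+1]. *)
rewrite exchange_big (eq_bigr (fun _ => ballot n.+1 k.+1)) => [|i _].
  by rewrite sum_nat_const card_ord.
by apply: ballot_conv; rewrite -ltnS ltn_ord.
Qed.

Lemma fixw_size w : fixw w <= size w.
Proof. by rewrite /fixw -[X in _ <= X](size_iota 0) count_size. Qed.

(** Both sides are the trinomial coefficient choosing disjoint sets of sizes [k] and [j] among [f]
    elements; they vanish for [f < k + j]. *)
Lemma bin_trinomial f k j : 'C(j + k, k) * 'C(f, k + j) = 'C(f, k) * 'C(f - k, j).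
Proof.
have [hf|hf] := leqP (k + j) f; last first.
  rewrite [X in _ * X]bin_small // muln0.
  have [hk|hk] := leqP k f; last by rewrite bin_small.
  by rewrite [X in _ = _ * X]bin_small ?muln0 //; lia.
have h1 := bin_fact hf.
have h2 : 'C(j + k, k) * (k`! * j`!) = (k + j)`!.
  by rewrite -{2}(addnK k j) bin_fact ?leq_addl // addnC.
have h3 : 'C(f, k) * (k`! * (f - k)`!) = f`! by apply: bin_fact; lia.
have h4 : 'C(f - k, j) * (j`! * (f - (k + j))`!) = (f - k)`!.
  by rewrite subnDA; apply: bin_fact; lia.
apply/eqP; rewrite -(eqn_pmul2r (fact_gt0 k)) -(eqn_pmul2r (fact_gt0 j)).
rewrite -(eqn_pmul2r (fact_gt0 (f - (k + j)))); apply/eqP.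
transitivity f`!; first by rewrite -h1 -h2; ring.
by rewrite -h3 -h4; ring.
Qed.

Local Open Scope ring_scope.

Lemma alternating_bin (R : pzRingType) m N : (m <= N)%N ->
  \sum_(0 <= j < N.+1) (-1) ^+ j * 'C(m, j)%:R = (m == 0)%:R :> R.
Proof.
case: m => [|m] hm.
  rewrite big_nat_recl // big1 => [|j _]; last by rewrite bin0n mulr0.
  by rewrite addr0 mul1r.
(* The partial alternating sums of a row of Pascal's triangle telescope to a single binomial, which
   is zero since [m < N]. *)
suff -> : \sum_(0 <= j < N.+1) (-1) ^+ j * 'C(m.+1, j)%:R = (-1) ^+ N * 'C(m, N)%:R :> R.
  by rewrite bin_small ?mulr0.
elim: N {hm} => [|N IH]; first by rewrite big_nat1 !bin0.
by rewrite big_nat_recr //= IH binS natrD mulrDr exprS mulN1r !mulNr addrCA subrr addr0.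
Qed.

(** Binomial inversion, done word by word: the indicator of [fixw w = k] is expanded. Stopping at
    [n - k] suffices because [fixw w <= n]. *)
Lemma count_fixw_moments (r : seq (seq nat)) n k :
  {in r, forall w, size w = n} -> (k <= n)%N ->
  (count (fun w => fixw w == k) r)%:R
    = \sum_(0 <= j < (n - k).+1)
        (-1) ^+ j * 'C(j + k, k)%:R * (\sum_(w <- r) 'C(fixw w, k + j))%:R :> rat.
Proof.
move=> hr hk; rewrite -sum1_count natr_sum.
under [RHS]eq_bigr do rewrite natr_sum big_distrr.
rewrite exchange_big big_mkcond /= big_seq [RHS]big_seq.
apply: eq_bigr => w /hr sw; have hf := fixw_size w; rewrite sw in hf.
transitivity ('C(fixw w, k)%:R * \sum_(0 <= j < (n - k).+1) (-1) ^+ j * 'C(fixw w - k, j)%:R : rat).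
  rewrite alternating_bin; last by apply: leq_sub2r.
  case: (ltngtP (fixw w) k) => hfk.
  - by rewrite bin_small ?mul0r.
  - by rewrite subn_eq0 leqNgt hfk mulr0.
  - by rewrite hfk binn subnn mulr1.
rewrite big_distrr; apply: eq_bigr => j _ /=.
by rewrite -[RHS]mulrA -natrM bin_trinomial natrM mulrCA.
Qed.

Local Close Scope ring_scope.

(** * From permutations to words, and the reverse-complement *)

Section Words.
Variable n : nat.

Definition word (pi : 'S_n) : seq nat := [seq val (pi i) | i <- enum 'I_n].

Lemma size_word pi : size (word pi) = n.
Proof. by rewrite size_map size_enum_ord. Qed.

Lemma nth_word pi (i : 'I_n) : nth 0 (word pi) i = pi i.
Proof. by rewrite (nth_map i) ?size_enum_ord // nth_ord_enum. Qed.

Lemma word_inj : injective word.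
Proof.
by move=> pi rho e; apply/permP => i; apply: val_inj; rewrite /= -!nth_word e.
Qed.

Lemma word_perm pi : perm_eq (word pi) (iota 0 n).
Proof.
apply/perm_wordP; split; first exact: size_word.
  by move=> x hx; rewrite -[x]/(val (Ordinal hx)) nth_word ltn_ord.
move=> x y hx hy; rewrite -[x]/(val (Ordinal hx)) -[y]/(val (Ordinal hy)) !nth_word.
by move/val_inj/perm_inj => ->.
Qed.

(** The map [word] is injective into a list of the same size [n!]. *)
Lemma words_permutations :
  perm_eq [seq word pi | pi <- enum {perm 'I_n}] (permutations (iota 0 n)).
Proof.
have uw : uniq [seq word pi | pi <- enum {perm 'I_n}].
  by rewrite (map_inj_uniq word_inj) enum_uniq.
have sub : {subset [seq word pi | pi <- enum {perm 'I_n}] <= permutations (iota 0 n)}.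
  by move=> _ /mapP[pi _ ->]; rewrite mem_permutations word_perm.
apply: uniq_perm => //; first exact: permutations_uniq.
have [|_] // := uniq_min_size uw sub.
rewrite size_permutations ?iota_uniq // size_iota size_map -cardE.
by rewrite card_Sn.
Qed.

Lemma card_fixed_points (pi : 'S_n) : #|fixed_points pi| = fixw (word pi).
Proof.
rewrite /fixw size_word -val_enum_ord count_map cardsE cardE enumT size_filter.
by apply: eq_count => i /=; rewrite nth_word.
Qed.

Lemma avoids_word alpha P (pi : 'S_n) :
  (forall x y z, order_iso [:: x; y; z] alpha = P x y z) ->
  avoids alpha pi = pattern_free P (word pi).
Proof.
move=> isoE; apply/forallP/pattern_freeP => [H i j l hij hjl | H i].
  rewrite size_word => hl; have hj := ltn_trans hjl hl; have hi := ltn_trans hij hj.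
  have /forallP/(_ (Ordinal hj))/forallP/(_ (Ordinal hl)) := H (Ordinal hi).
  by rewrite /= hij hjl isoE -!nth_word.
apply/forallP => j; apply/forallP => l; apply/implyP => /andP[hij hjl].
by rewrite isoE /= -!nth_word; apply: H; rewrite ?size_word.
Qed.

Lemma s_count_Av alpha P k :
  (forall x y z, order_iso [:: x; y; z] alpha = P x y z) ->
  s_count alpha n k = count (fun w => fixw w == k) (Av P n).
Proof.
move=> isoE; rewrite count_filter -(seq.permP words_permutations) count_map.
rewrite /s_count cardsE cardE enumT size_filter -enumT enumT.
apply: eq_count => pi /=.
by rewrite unfold_in /= (avoids_word _ isoE) card_fixed_points andbC.
Qed.

Definition revcomp (pi : 'S_n) : 'S_n :=
  perm (inj_comp (inj_comp (@rev_ord_inj n) (@perm_inj _ pi)) (@rev_ord_inj n)).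

Lemma revcompE pi i : revcomp pi i = rev_ord (pi (rev_ord i)).
Proof. by rewrite permE. Qed.

Lemma revcompK : involutive revcomp.
Proof. by move=> pi; apply/permP => i; rewrite !revcompE !rev_ordK. Qed.

(** Conjugation by [rev_ord] carries fixed points to their images under [rev_ord]. *)
Lemma fixed_points_revcomp pi : #|fixed_points (revcomp pi)| = #|fixed_points pi|.
Proof.
rewrite -[RHS](card_imset _ (@rev_ord_inj n)); apply: eq_card => i.
rewrite inE revcompE -[i in RHS]rev_ordK mem_imset ?inE; last exact: rev_ord_inj.
by rewrite -{2}[i]rev_ordK (inj_eq rev_ord_inj).
Qed.

End Words.

(** Reduces the test to six comparisons of numbers, which [lia] decides for each concrete
    pattern. *)
Lemma order_iso3P x y z (alpha : seq nat) : size alpha = 3 ->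
  order_iso [:: x; y; z] alpha =
   [&& (x < y) == (nth 0 alpha 0 < nth 0 alpha 1),
       (y < x) == (nth 0 alpha 1 < nth 0 alpha 0),
       (x < z) == (nth 0 alpha 0 < nth 0 alpha 2),
       (z < x) == (nth 0 alpha 2 < nth 0 alpha 0),
       (y < z) == (nth 0 alpha 1 < nth 0 alpha 2)
     & (z < y) == (nth 0 alpha 2 < nth 0 alpha 1)].
Proof.
move=> sa; rewrite /order_iso sa eqxx /=.
apply/forallP/and5P => [H | [h1 h2 h3 h4 /andP[h5 h6]] a].
  have G a b (ha : a < 3) (hb : b < 3) := forallP (H (Ordinal ha)) (Ordinal hb).
  split; [exact: G 0 1 _ _ | exact: G 1 0 _ _ | exact: G 0 2 _ _ | exact: G 2 0 _ _ |].
  by apply/andP; split; [exact: G 1 2 _ _ | exact: G 2 1 _ _].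
apply/forallP => -[[|[|[|b]]] hb] //; case: a => [[|[|[|a]]] ha] //=.
all: by rewrite ?ltnn.
Qed.

Lemma order_iso132 x y z : order_iso [:: x; y; z] [:: 1; 3; 2] = p132 x y z.
Proof. by rewrite order_iso3P // /p132 /=; lia. Qed.

Lemma order_iso321 x y z : order_iso [:: x; y; z] [:: 3; 2; 1] = p321 x y z.
Proof. by rewrite order_iso3P // /p321 /=; lia. Qed.

Lemma order_iso213 x y z : order_iso [:: x; y; z] [:: 2; 1; 3] = (y < x) && (x < z).
Proof. by rewrite order_iso3P //=; lia. Qed.

(** Reversing 213 gives 312, and complementing its values gives 132; the positions [i < j < l]
    become their mirror images in reverse order. *)
Lemma avoids_revcomp n (pi : 'S_n) :
  avoids [:: 2; 1; 3] (revcomp pi) = avoids [:: 1; 3; 2] pi.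
Proof.
have revlt (i j : 'I_n) : (rev_ord i < rev_ord j) = (j < i).
  by have := ltn_ord i; have := ltn_ord j; rewrite /=; lia.
apply/forallP/forallP => H i; apply/forallP => j; apply/forallP => l;
  apply/implyP => /andP[hij hjl].
  have /forallP/(_ (rev_ord j))/forallP/(_ (rev_ord i)) := H (rev_ord l).
  rewrite !revlt hij hjl /= order_iso132 order_iso213 !revcompE !rev_ordK.
  by rewrite !revlt /p132 andbC.
have /forallP/(_ (rev_ord j))/forallP/(_ (rev_ord i)) := H (rev_ord l).
rewrite !revlt hij hjl /= order_iso132 order_iso213 !revcompE.
by rewrite !revlt /p132 andbC.
Qed.

Lemma s_count_213 n k : s_count [:: 2; 1; 3] n k = s_count [:: 1; 3; 2] n k.
Proof.
rewrite /s_count.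
rewrite -[LHS](on_card_preimset (f := @revcomp n)); last first.
  exact: onW_bij (inv_bij (@revcompK n)).
by apply: eq_card => pi; rewrite !inE avoids_revcomp fixed_points_revcomp.
Qed.

Local Open Scope ring_scope.

Lemma s_count_alternating alpha P n k :
  (forall x y z, order_iso [:: x; y; z] alpha = P x y z) ->
  (forall m i, \sum_(w <- Av P m) 'C(fixw w, i) = ballot m i)%N ->
  (k <= n)%N ->
  (s_count alpha n k)%:R
    = \sum_(0 <= j < (n - k).+1) (-1) ^+ j * 'C(j + k, k)%:R * Cnk n (k + j).
Proof.
move=> isoE momE hk; rewrite (s_count_Av _ _ isoE) (count_fixw_moments _ hk).
  rewrite big_nat [RHS]big_nat; apply: eq_bigr => j hj.
  by rewrite momE Cnk_catalan_conv /ballot ?ifT //; lia.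
by move=> w /AvE[].
Qed.

Theorem theorem7p5 (alpha : seq nat)
    (halpha : alpha \in [:: [:: 1; 3; 2]; [:: 3; 2; 1]; [:: 2; 1; 3]]%N)
    (n k : nat) (hn : (1 <= n)%N) (hk : (k <= n)%N) :
  (s_count alpha n k)%:R
    = \sum_(0 <= j < (n - k).+1) (-1) ^+ j * 'C(j + k, k)%:R * Cnk n (k + j)
  /\
  \sum_(0 <= j < (n - k).+1) (-1) ^+ j * 'C(j + k, k)%:R * Cnk n (k + j)
    = \sum_(0 <= j < (n - k).+1)
        (-1) ^+ j * ((j + k + 1)%:R / (n + 1)%:R)
          * 'C(2 * n - k - j, n)%:R * 'C(j + k, k)%:R :> rat.
Proof.
split; last first.
  (* The second identity holds termwise, by unfolding [Cnk] and reordering factors. *)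
  apply: eq_bigr => j _; rewrite /Cnk !addn1 -subnDA (addnC k j).
  by rewrite mulrAC !mulrA.
have s132 := s_count_alternating order_iso132 (marked_moments sum_marked132 size_Av132) hk.
have s321 := s_count_alternating order_iso321 (marked_moments sum_marked321 size_Av321) hk.
by move: halpha; rewrite !inE => /or3P[] /eqP ->; rewrite ?s_count_213.
Qed.
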